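(* Let $\Gamma=\{\gamma_1,\dots,\gamma_{|\Gamma|}\}$ be a finite group acting on $\mathbb{R}^n$ by the maps $\gamma_\rho$, $\gamma\in\Gamma$. Let $(x_m,y_m)_{m=1}^M$ be pairs of points of $\mathbb{R}^n$ that respect the symmetry, i.e. $\{(\gamma_\rho x_m,\gamma_\rho y_m)\}_{m=1}^M=\{(x_m,y_m)\}_{m=1}^M$ (as collections counted with multiplicity) for every $\gamma\in\Gamma$. Let $\mathcal{D}$ be a linearly independent dictionary of $N$ observables of the form $\gamma_{j,\rho}\circ\psi_a$, $1\le j\le|\Gamma|$, $1\le a\le N/|\Gamma|$, where $\psi_a:\mathbb{R}^n\to\mathbb{C}$, arranged in the row vector $\Psi(x)$ described in the context. Let $G=\sum_m\Psi(x_m)^*\Psi(x_m)$, $A=\sum_m\Psi(x_m)^*\Psi(y_m)$, and let $K=G^{+}A$ be the EDMD approximation of the Koopman operator. Then for every $\gamma\in\Gamma$ $$\mathbf{P}_\gamma G=G\,\mathbf{P}_\gamma,\qquad \mathbf{P}_\gamma A=A\,\mathbf{P}_\gamma,\qquad \mathbf{P}_\gamma K=K\,\mathbf{P}_\gamma .$$ Consequently, regarded as the linear operator on $\operatorname{span}(\mathcal{D})$ sending $\Psi(\cdot)c$ to $\Psi(\cdot)Kc$ for $c\in\mathbb{C}^N$, $K$ maps each isotypic component of $\operatorname{span}(\mathcal{D})$ with respect to the action of $\Gamma$ into itself, so that $K$ is block diagonal in a basis adapted to the isotypic decomposition.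
   Context: The set of actions $\{\gamma_\rho:\gamma\in\Gamma\}$ is a group isomorphic to $\Gamma$. The group acts on functions by $(\gamma_\rho\circ f)(x)=f(\gamma_\rho^{-1}x)$. Write $\Psi_0(x)=(\psi_1(x),\dots,\psi_{N/|\Gamma|}(x))$. For the fixed ordering $\gamma_1,\dots,\gamma_{|\Gamma|}$ of the group, $\Psi(x)=\big(\gamma_{1,\rho}\circ\Psi_0(x)\ \ \dots\ \ \gamma_{|\Gamma|,\rho}\circ\Psi_0(x)\big)$, a row vector of length $N$. For $\gamma\in\Gamma$, $P_\gamma$ is the $|\Gamma|\times|\Gamma|$ permutation matrix determined by $P_\gamma(\gamma_1,\dots,\gamma_{|\Gamma|})^T=(\gamma\gamma_1,\dots,\gamma\gamma_{|\Gamma|})^T$, and $\mathbf{P}_\gamma=P_\gamma\otimes I$, with $I$ the identity matrix of size $N/|\Gamma|$. $^*$ denotes conjugate transpose and $^{+}$ the Moore–Penrose pseudoinverse. The isotypic component of a complex $\Gamma$-representation corresponding to an irreducible representation is the sum of all subrepresentations isomorphic to that irreducible representation; $\operatorname{span}(\mathcal{D})$ is a representation of $\Gamma$ via $f\mapsto\gamma_\rho\circ f$. *)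

(* Defs.v *)
(* MathComp, with MathComp-Analysis for the real numbers and for sets. *)
From HB Require Import structures.
From mathcomp Require Import all_boot all_order all_algebra all_fingroup.
From mathcomp Require Import boolp classical_sets functions reals.
From mathcomp Require Import complex mxtens.

Set Implicit Arguments.
Unset Strict Implicit.
Unset Printing Implicit Defensive.

Import Order.TTheory GRing.Theory Num.Theory.

Local Open Scope classical_set_scope.
Local Open Scope sesquilinear_scope.
Local Open Scope ring_scope.

(** * Moore-Penrose pseudoinverse *)

Section MoorePenrose.
Variable C : numClosedFieldType.

Definition penrose m n (A : 'M[C]_(m, n)) (X : 'M[C]_(n, m)) : Prop :=
  [/\ A *m X *m A = A, X *m A *m X = X,
      (A *m X)^t* = A *m X & (X *m A)^t* = X *m A].

Lemma conj_mul m n p (A : 'M[C]_(m, n)) (B : 'M[C]_(n, p)) :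
  (A *m B)^t* = B^t* *m A^t*.
Proof. by rewrite trmx_mul map_mxM. Qed.

Lemma conj_inv n (A : 'M[C]_n) : A^t* = A -> (invmx A)^t* = invmx A.
Proof. by move=> hA; rewrite trmx_inv map_invmx hA. Qed.

Lemma penrose_unique m n (A : 'M[C]_(m, n)) X Y :
  penrose A X -> penrose A Y -> X = Y.
Proof.
case=> x1 x2 x3 x4 [y1 y2 y3 y4].
have E1 : A *m X = A *m Y.
  by rewrite -x3 -{1}y1 -mulmxA conj_mul x3 y3 mulmxA x1.
have E2 : X *m A = Y *m A.
  by rewrite -x4 -{1}y1 -mulmxA mulmxA conj_mul x4 y4 -mulmxA [A *m _]mulmxA x1.
by rewrite -x2 E2 -mulmxA E1 mulmxA y2.
Qed.

Lemma gram_unit m n (A : 'M[C]_(m, n)) : row_free A -> A *m A^t* \in unitmx.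
Proof.
move=> fA; rewrite -row_free_unit -kermx_eq0; apply/rowV0P => v /sub_kermxP.
move=> h; apply: (row_free_inj fA); rewrite mul0mx.
have /eqP : dotmx (v *m A) (v *m A) = 0.
  by rewrite dotmxE conj_mul !mulmxA -(mulmxA v) h mul0mx mxE.
by rewrite dnorm_eq0 => /eqP.
Qed.

Lemma penrose_exists m n (A : 'M[C]_(m, n)) : exists X, penrose A X.
Proof.
have uD : row_base A *m (row_base A)^t* \in unitmx.
  by apply: gram_unit; exact: row_base_free.
have uB : (col_base A)^t* *m col_base A \in unitmx.
  rewrite -{2}[col_base A](trmxCK (col_base A)); apply: gram_unit.
  by rewrite /row_free mxrank_map mxrank_tr; exact: col_base_full.
have dA := mulmx_base A.
move: (\rank A) (col_base A) (row_base A) dA uD uB => r B D dA uD uB.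
have hD : (invmx (D *m D^t*))^t* = invmx (D *m D^t*).
  by apply: conj_inv; rewrite conj_mul trmxCK.
have hB : (invmx (B^t* *m B))^t* = invmx (B^t* *m B).
  by apply: conj_inv; rewrite conj_mul trmxCK.
set D' := D^t* *m invmx (D *m D^t*); set B' := invmx (B^t* *m B) *m B^t*.
have DD : D *m D' = 1%:M by rewrite mulmxA mulmxV.
have BB : B' *m B = 1%:M by rewrite -mulmxA mulVmx.
have AX : A *m (D' *m B') = B *m B'.
  by rewrite -dA -mulmxA (mulmxA D) DD mul1mx.
have XA : D' *m B' *m A = D' *m D.
  by rewrite -dA -mulmxA (mulmxA B') BB mul1mx.
exists (D' *m B'); split.
- by rewrite AX -dA -mulmxA (mulmxA B') BB mul1mx.
- by rewrite XA -mulmxA (mulmxA D) DD mul1mx.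
- by rewrite AX /B' !conj_mul hB trmxCK mulmxA.
- by rewrite XA /D' !conj_mul hD trmxCK mulmxA.
Qed.

Definition mpinv m n (A : 'M[C]_(m, n)) : 'M[C]_(n, m) :=
  xget 0 [set X | penrose A X].

Lemma mpinvP m n (A : 'M[C]_(m, n)) : penrose A (mpinv A).
Proof. exact: (xgetPex 0 (penrose_exists A)). Qed.

End MoorePenrose.

(** * Finite families of vectors *)

Section Families.
Variables (F : fieldType) (V : lmodType F).

Definition lincomb m (b : 'I_m -> V) (c : 'cV[F]_m) : V :=
  \sum_i c i 0 *: b i.

Definition lin_indep m (b : 'I_m -> V) : Prop :=
  forall c, lincomb b c = 0 -> c = 0.

Definition lin_span m (b : 'I_m -> V) : set V := range (lincomb b).

Definition is_basis (U : set V) m (b : 'I_m -> V) : Prop :=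
  lin_indep b /\ lin_span b = U.

Definition lin_subspace (W : set V) : Prop :=
  W 0 /\ forall (a : F) u v, W u -> W v -> W (a *: u + v).

(* The operator on [lin_span b] sending [lincomb b c] to [lincomb b (K *m c)]
   when [b] is linearly independent (see [lin_opE]). Its values outside
   [lin_span b] are irrelevant. *)
Definition lin_op m (b : 'I_m -> V) (K : 'M[F]_m) (v : V) : V :=
  lincomb b (K *m xget 0 [set c | lincomb b c = v]).

Lemma lincombB m (b : 'I_m -> V) c c' :
  lincomb b (c - c') = lincomb b c - lincomb b c'.
Proof.
rewrite /lincomb -sumrB; apply: eq_bigr => i _.
by rewrite !mxE scalerBl.
Qed.

Lemma lin_opE m (b : 'I_m -> V) K c :
  lin_indep b -> lin_op b K (lincomb b c) = lincomb b (K *m c).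
Proof.
move=> fb; rewrite /lin_op; set c' := xget _ _.
suff -> : c' = c by [].
have /= h : lincomb b c' = lincomb b c.
  by apply: (@xgetPex _ 0 [set d | lincomb b d = lincomb b c]); exists c.
by apply/eqP; rewrite -subr_eq0; apply/eqP/fb; rewrite lincombB h subrr.
Qed.

(* The columns of [M] are the coordinates of the images of basis vectors. *)
Definition is_matrix_of (T : V -> V) m (b : 'I_m -> V) (M : 'M[F]_m) : Prop :=
  forall j, T (b j) = lincomb b (col j M).

End Families.

(** * Group actions and linear representations *)

Definition is_left_action (gT : finGroupType) (T : Type)
    (a : gT -> T -> T) : Prop :=
  (forall t, a 1%g t = t) /\ (forall g h t, a (g * h)%g t = a g (a h t)).

Record linrep (F : fieldType) (gT : finGroupType) := LinRep {
  rep_space :> lmodType F;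
  rep_act : gT -> rep_space -> rep_space;
  rep_linear : forall g, linear (rep_act g);
  rep_action : is_left_action rep_act
}.

Section Isotypic.
Variables (F : fieldType) (gT : finGroupType).

Definition subrep (V : lmodType F) (a : gT -> V -> V) (U W : set V) : Prop :=
  [/\ lin_subspace W, W `<=` U & forall g v, W v -> W (a g v)].

Definition irreducible_rep (S : linrep F gT) : Prop :=
  (exists v : S, v != 0) /\
  forall W : set S, subrep (@rep_act _ _ S) setT W -> W = [set 0] \/ W = setT.

Definition rep_iso (S : linrep F gT) (V : lmodType F) (a : gT -> V -> V)
    (W : set V) : Prop :=
  exists phi : {linear S -> V},
    [/\ injective phi, range phi = W
      & forall g v, phi (rep_act g v) = a g (phi v)].

(* The sum of all subrepresentations of [U] isomorphic to [S]. *)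
Definition isotypic (S : linrep F gT) (V : lmodType F) (a : gT -> V -> V)
    (U : set V) : set V :=
  [set v | exists (k : nat) (w : 'I_k -> V),
     (forall i, exists W, [/\ subrep a U W, rep_iso S a W & W (w i)])
     /\ v = \sum_i w i].

(* [b] is a basis of [U] obtained by concatenating bases of the isotypic
   components of [U], the [i]-th block having length [d i]; [Rank i j] is the
   position of the [j]-th vector of the [i]-th block. Blocks may be empty. *)
Definition isotypic_basis (V : lmodType F) (a : gT -> V -> V) (U : set V)
    (k : nat) (S : 'I_k -> linrep F gT) (d : 'I_k -> nat)
    (b : 'I_(\sum_i d i) -> V) : Prop :=
  [/\ forall i, irreducible_rep (S i),
      forall i j, rep_iso (S i) (@rep_act _ _ (S j)) setT -> i = j,
      forall i, is_basis (isotypic (S i) a U)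
                         (fun j : 'I_(d i) => b (tagnat.Rank i j))
    & is_basis U b].

End Isotypic.

(** * Extended dynamic mode decomposition with a symmetric dictionary *)

Section EDMD.
Variables (R : realType) (gT : finGroupType) (n : nat).

(* [R[i]^o] is [R[i]] seen as a vector space over itself. *)
Definition observable := ('rV[R]_n -> R[i]^o)%type.

Variable rho : gT -> 'rV[R]_n -> 'rV[R]_n.

Definition obs_act (g : gT) (f : observable) : observable :=
  fun x => f (rho g^-1%g x).

Variables (e : 'I_#|gT| -> gT) (p : nat) (psi : 'I_p -> observable).

(* The pair encoded by [k] is [(j, a)] with [k = j * p + a]: the group element
   is the slow index, as for the Kronecker product [*t]. *)
Definition dict (k : 'I_(#|gT| * p)) : observable :=
  obs_act (e (mxtens_unindex k).1) (psi (mxtens_unindex k).2).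

Definition Psi (x : 'rV[R]_n) : 'rV[R[i]]_(#|gT| * p) := \row_k dict k x.

Lemma lincomb_dictE c x : lincomb dict c x = (Psi x *m c) 0 0.
Proof.
rewrite /lincomb mxE fct_sumE; apply: eq_bigr => k _.
by rewrite !mxE mulrC.
Qed.

Variables (M : nat) (x y : 'I_M -> 'rV[R]_n).

Definition edmd_G : 'M[R[i]]_(#|gT| * p) :=
  \sum_m (Psi (x m))^t* *m Psi (x m).

Definition edmd_A : 'M[R[i]]_(#|gT| * p) :=
  \sum_m (Psi (x m))^t* *m Psi (y m).

Definition edmd_K : 'M[R[i]]_(#|gT| * p) := mpinv edmd_G *m edmd_A.

(* Row [i] selects the index [j] such that [e j = g * e i]. *)
Definition perm_G (g : gT) : 'M[R[i]]_#|gT| :=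
  \matrix_(i, j) (e j == g * e i)%g%:R.

Definition bigperm_G (g : gT) : 'M[R[i]]_(#|gT| * p) := perm_G g *t 1%:M.

End EDMD.

(* Main.v *)
From HB Require Import structures.
Require Import Defs.
From mathcomp Require Import all_boot all_order all_algebra all_fingroup.
From mathcomp Require Import mxrepresentation pgroup.
From mathcomp Require Import boolp classical_sets functions reals.
From mathcomp Require Import complex mxtens.

(** The matrices [P_g] are unitary and [Psi (g^-1 x) = Psi x P_g^T], so summing
    over the symmetric data gives [P_g G P_g^* = G] and [P_g A P_g^* = A]; the
    pseudoinverse of [G] then commutes with [P_g] because the Penrose conditions
    are unitarily invariant. Hence the operator given by [K] is equivariant, and
    by Schur's lemma it sends a copy of an irreducible [S] to zero or to another
    copy of [S]. In coordinates the span of the dictionary is a matrix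
    representation, semisimple by Maschke's theorem, whose socle components are
    the isotypic components; concatenating bases of these gives an adapted
    basis, in which the operator is block diagonal. *)

Import Order.TTheory GRing.Theory Num.Theory.
Local Open Scope ring_scope.

Set Implicit Arguments.
Unset Strict Implicit.
Local Open Scope classical_set_scope.
Local Open Scope sesquilinear_scope.

(** * Pseudoinverses of matrices commuting with a unitary matrix *)

Section PseudoinverseCommutation.
Variable C : numClosedFieldType.

(** Conjugating [mpinv A] by [U] again solves the Penrose equations for [A], so [penrose_unique]
    identifies the two. *)
Lemma mpinv_comm_unitary n (A U : 'M[C]_n) :
  U *m U^t* = 1%:M -> U *m A = A *m U -> U *m mpinv A = mpinv A *m U.
Proof.
move=> uU cUA; have vU : U^t* *m U = 1%:M by exact: mulmx1C.
have [x1 x2 x3 x4] := mpinvP A.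
have cUA' : U^t* *m A = A *m U^t*.
  by rewrite -[A in LHS]mulmx1 -uU (mulmxA A) -cUA !mulmxA vU mul1mx.
suff E : U *m mpinv A *m U^t* = mpinv A by rewrite -[in RHS]E -mulmxA vU mulmx1.
apply: penrose_unique (mpinvP A).
have AX : A *m (U *m mpinv A *m U^t*) = U *m (A *m mpinv A) *m U^t*.
  by rewrite !mulmxA -cUA.
have XA : U *m mpinv A *m U^t* *m A = U *m (mpinv A *m A) *m U^t*.
  by rewrite -(mulmxA _ _ A) cUA' !mulmxA.
split.
- by rewrite AX -(mulmxA _ _ A) cUA' mulmxA -(mulmxA U) x1 cUA -mulmxA uU mulmx1.
- rewrite XA -(mulmxA _ _ (U *m _ *m _)) !mulmxA -(mulmxA _ _ U) vU mulmx1.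
  by rewrite -!mulmxA (mulmxA A) (mulmxA (mpinv A)) (mulmxA (mpinv A)) x2.
- by rewrite AX conj_mul (conj_mul U) x3 trmxCK mulmxA.
- by rewrite XA conj_mul (conj_mul U) x4 trmxCK mulmxA.
Qed.

End PseudoinverseCommutation.

(** * Symmetry of the dictionary and of the EDMD matrices *)

Section SymmetricDictionary.
Variables (R : realType) (gT : finGroupType) (n : nat).
Variable rho : gT -> 'rV[R]_n -> 'rV[R]_n.
Hypothesis rho_action : is_left_action rho.
Variables (e : 'I_#|gT| -> gT) (p : nat) (psi : 'I_p -> observable R n).
Hypothesis e_bij : bijective e.

Lemma bigperm_G_unitary g :
  bigperm_G R e p g *m (bigperm_G R e p g)^t* = 1%:M.
Proof.
have [e' eK e'K] := e_bij.
rewrite /bigperm_G trmx_tens map_mxT trmx1 map_mx1 tensmx_mul mulmx1.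
suff -> : perm_G R e g *m (perm_G R e g)^t* = 1%:M.
  apply/matrixP=> k l; rewrite !mxE -natrM mulnb -xpair_eqE -!surjective_pairing.
  by rewrite (can_eq (@mxtens_unindexK _ _)).
(* Row [i] of [perm_G] has its only 1 in column [e' (g * e i)]. *)
apply/matrixP=> i j; rewrite !mxE (bigD1 (e' (g * e i)%g)) //= !mxE e'K eqxx.
rewrite mul1r (inj_eq (mulgI g)) (can_eq eK) eq_sym conjC_nat big1 ?addr0 //.
move=> k; rewrite -(can_eq eK) e'K !mxE => /negPf ->.
by rewrite eq_sym mul0r.
Qed.

Lemma bigperm_GE g i a j b :
  bigperm_G R e p g (mxtens_index (i, a)) (mxtens_index (j, b))
    = (e j == (g * e i)%g)%:R * (a == b)%:R.
Proof. by rewrite /bigperm_G tensmxE !mxE. Qed.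

(** Since [rho (e j)^-1] after [rho g^-1] is [rho (g * e j)^-1], translating the argument moves slot
    [(j, a)] to the slot of [(g * e j, a)]. *)
Lemma Psi_act g x :
  Psi rho e psi (rho g^-1%g x) = Psi rho e psi x *m (bigperm_G R e p g)^T.
Proof.
have [e' eK e'K] := e_bij; have [_ rhoM] := rho_action.
apply/rowP=> k; rewrite [LHS]mxE [RHS]mxE.
have [[j a] ->] : exists ja, k = mxtens_index ja.
  by exists (mxtens_unindex k); rewrite mxtens_unindexK.
rewrite (bigD1 (mxtens_index (e' (g * e j)%g, a))) //= big1 => [|l].
  rewrite mxE [_^T _ _]mxE bigperm_GE e'K !eqxx !mulr1 addr0 /dict /obs_act.
  by rewrite !mxtens_indexK /= e'K invMg rhoM.
have [[i c] ->] : exists ja, l = mxtens_index ja.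
  by exists (mxtens_unindex l); rewrite mxtens_unindexK.
rewrite (can_eq (@mxtens_indexK _ _)) xpair_eqE [_^T _ _]mxE bigperm_GE.
rewrite -[i == _](can_eq eK) e'K (eq_sym c).
by do 2![case: (_ == _); rewrite ?(mulr0, mulr1) //=].
Qed.

Lemma bigperm_G_real g : (bigperm_G R e p g)^t* = (bigperm_G R e p g)^T.
Proof.
apply/matrixP=> i j; rewrite !mxE.
by case: eqP; case: eqP; rewrite ?mulr1 ?mulr0 ?conjC0 ?conjC1.
Qed.

(** Translating a data pair by [g^-1] conjugates its summand by [P], while symmetry of the data
    leaves the sum unchanged. *)
Lemma edmd_A_comm M (x y : 'I_M -> 'rV[R]_n) g :
  perm_eq [seq (rho g^-1%g (x m), rho g^-1%g (y m)) | m : 'I_M]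
          [seq (x m, y m) | m : 'I_M] ->
  bigperm_G R e p g *m edmd_A rho e psi x y
    = edmd_A rho e psi x y *m bigperm_G R e p g.
Proof.
move=> sym; set P := bigperm_G R e p g.
have uP : P *m P^t* = 1%:M by exact: bigperm_G_unitary.
have PT : P^T = P^t* by rewrite bigperm_G_real.
(* As a function of the pair alone, the summand can be summed over the list of pairs in any
   order. *)
pose F z := (Psi rho e psi z.1)^t* *m Psi rho e psi z.2.
have AE (x' y' : 'I_M -> 'rV[R]_n) : edmd_A rho e psi x' y' =
    \sum_(z <- [seq (x' m, y' m) | m : 'I_M]) F z.
  by rewrite big_map big_enum.
suff {2}-> : edmd_A rho e psi x y = P *m edmd_A rho e psi x y *m P^t*.
  by rewrite -mulmxA (mulmx1C uP) mulmx1.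
rewrite {1}AE -(perm_big _ sym) /= big_map big_enum /= mulmx_sumr mulmx_suml.
apply: eq_bigr => m _; rewrite /F /= !Psi_act -/P [in LHS]PT conj_mul trmxCK.
by rewrite !mulmxA.
Qed.

(** This is the case [y = x] of [edmd_A_comm]; the pairs [(x m, x m)] inherit the symmetry by
    projection. *)
Lemma edmd_G_comm M (x y : 'I_M -> 'rV[R]_n) g :
  perm_eq [seq (rho g^-1%g (x m), rho g^-1%g (y m)) | m : 'I_M]
          [seq (x m, y m) | m : 'I_M] ->
  bigperm_G R e p g *m edmd_G rho e psi x
    = edmd_G rho e psi x *m bigperm_G R e p g.
Proof.
move=> /(perm_map (fun z => (z.1, z.1))); rewrite -!(map_comp (fun z => (z.1, z.1))).
exact: (@edmd_A_comm M x x g).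
Qed.

Lemma edmd_K_comm M (x y : 'I_M -> 'rV[R]_n) g :
  perm_eq [seq (rho g^-1%g (x m), rho g^-1%g (y m)) | m : 'I_M]
          [seq (x m, y m) | m : 'I_M] ->
  bigperm_G R e p g *m edmd_K rho e psi x y
    = edmd_K rho e psi x y *m bigperm_G R e p g.
Proof.
move=> sym; rewrite /edmd_K mulmxA -[RHS]mulmxA -edmd_A_comm // mulmxA.
have cG := edmd_G_comm sym.
by rewrite (mpinv_comm_unitary (bigperm_G_unitary g) cG).
Qed.

Lemma obs_act_left : is_left_action (obs_act rho).
Proof.
have [rho1 rhoM] := rho_action; split=> [f|g h f]; apply/funext => x.
  by rewrite /obs_act invg1 rho1.
by rewrite /obs_act invMg rhoM.
Qed.

End SymmetricDictionary.

(** * Schur's lemma for an equivariant map that is linear on [U] only *)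

Section SchurIsotypic.
Variables (F : fieldType) (gT : finGroupType) (V : lmodType F).
Variables (a : gT -> V -> V) (U : set V) (T : V -> V).
Hypothesis T_lin : forall (k : F) u v,
  U u -> U v -> T (k *: u + v) = k *: T u + T v.
Hypothesis T_stable : forall u, U u -> U (T u).
Hypothesis T_equiv : forall g u, U u -> T (a g u) = a g (T u).

(* The image under [T] of a subrepresentation isomorphic to [S] is zero or
   again isomorphic to [S]. *)
Lemma isotypic_equivariant_stable (S : linrep F gT) :
  lin_subspace U -> irreducible_rep S ->
  forall v, isotypic S a U v -> isotypic S a U (T v).
Proof.
move=> [U0 Ulin] [_ Sirr] v [k [w [wP ->]]].
have T0 : T 0 = 0.
  by have := T_lin (-1) U0 U0; rewrite scaler0 addr0 scaleN1r addNr.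
have wU i : U (w i) by have [W [[_ WU _] _ /WU]] := wP i.
(* Membership in [U] is carried through the induction because [T_lin] applies only to vectors of
   [U]. *)
have Tsum (I : seq 'I_k) :
    U (\sum_(i <- I) w i) /\ T (\sum_(i <- I) w i) = \sum_(i <- I) T (w i).
  elim: I => [|i I [IHU IHT]]; first by rewrite !big_nil.
  rewrite !big_cons -[w i]scale1r; split; first exact: Ulin.
  by rewrite T_lin // !scale1r IHT.
exists k, (fun i => T (w i)); split; last by case: (Tsum (index_enum 'I_k)).
move=> i; have [W [subW [phi [phi_inj phiW phi_eq]] Ww]] := wP i.
have [[W0 Wlin] WU Wstab] := subW.
have phiU s : U (phi s) by apply: WU; rewrite -phiW; exists s.
have Tphi_lin : linear (T \o phi).
  by move=> c s t; rewrite /= linearP T_lin.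
have Tphi_eq g s : T (phi (rep_act g s)) = a g (T (phi s)).
  by rewrite phi_eq T_equiv.
(* The kernel of [T \o phi] is a subrepresentation of [S], hence zero or everything. *)
pose K : set S := [set s | T (phi s) = 0].
(* As [a] is a bare function, [a g 0 = 0] is transported from the linear action on [S]. *)
have a0 g : T (phi (rep_act g 0)) = 0.
  have -> : rep_act g (0 : S) = 0; last by rewrite linear0.
  have := rep_linear g (-1) (0 : S) 0.
  by rewrite scaler0 addr0 scaleN1r addNr.
have [|K0|KT] := Sirr K.
- split=> //; first split=> /=.
  + by rewrite /K /= linear0.
  + move=> c s t; rewrite /K /= linearP T_lin // => -> ->.
    by rewrite scaler0 addr0.
  + move=> g s; rewrite /K /= Tphi_eq => ->.
    by rewrite -[RHS](a0 g) Tphi_eq linear0 T0.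
- pose L : {linear S -> V} :=
    HB.pack (T \o phi) (GRing.isLinear.Build _ _ _ _ _ Tphi_lin).
  exists (range L); split.
  + split.
    * split; first by exists 0 => //; rewrite linear0.
      move=> c _ _ [s _ <-] [t _ <-].
      by exists (c *: s + t) => //; rewrite linearP.
    * by move=> _ [s _ <-]; exact: T_stable.
    * by move=> g _ [s _ <-]; exists (rep_act g s) => //; exact: Tphi_eq.
  + exists L; split=> // s t Est; apply/eqP; rewrite -subr_eq0; apply/eqP.
    have : K (s - t) by have : L (s - t) = 0 by rewrite linearB Est subrr.
    by rewrite K0.
  + by move: Ww; rewrite -phiW => -[s _ <-]; exists s.
(* Here [T] kills [W], and [T (w i) = 0] still lies in the copy [W] of [S]. *)
- exists W; split=> //; first by exists phi.
  move: Ww; rewrite -phiW => -[s _ <-].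
  have -> : T (phi s) = 0 by have : K s by rewrite KT.
  by rewrite -(linear0 phi); exists 0.
Qed.

End SchurIsotypic.

(** * From matrix representations to abstract linear representations *)

Section MatrixRepresentations.
Variables (F : fieldType) (gT : finGroupType).
Local Notation G := [set: gT]%G.

(* Matrix representations act on row vectors from the right, hence [g^-1]. *)
Definition row_action n (rG : mx_representation F G n) (g : gT) (v : 'rV[F]_n) :=
  v *m rG g^-1%g.

Lemma row_action_linear n (rG : mx_representation F G n) g :
  linear (row_action rG g).
Proof. by move=> c u v; rewrite /row_action mulmxDl scalemxAl. Qed.

Lemma row_action_left n (rG : mx_representation F G n) :
  is_left_action (row_action rG).
Proof.
split=> [v|g h v]; first by rewrite /row_action invg1 repr_mx1 mulmx1.
by rewrite /row_action invMg repr_mxM ?inE // mulmxA.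
Qed.

Definition mx_linrep n (rG : mx_representation F G n) : linrep F gT :=
  LinRep (row_action_linear rG) (row_action_left rG).

(** An invariant set with a nonzero vector [w] contains the cyclic module of [w], which is the whole
    space by irreducibility of [rG]. *)
Lemma mx_linrep_irreducible n (rG : mx_representation F G n) :
  mx_irreducible rG -> irreducible_rep (mx_linrep rG).
Proof.
move=> /mx_irrP[n_gt0 rG_irr]; split.
  exists (const_mx 1); apply/eqP=> /rowP/(_ (Ordinal n_gt0)).
  by rewrite !mxE; apply/eqP/oner_neq0.
move=> W [[W0 Wlin] _ Wstab].
have [[w [Ww w_neq0]]|Wtriv] := pselect (exists w, W w /\ w != 0); last first.
  left; apply/seteqP; split=> [w Ww|w ->] //=; apply/eqP/negPn/negP => w_neq0.
  by apply: Wtriv; exists w.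
right; apply/seteqP; split=> // v _.
have wfull : row_full (cyclic_mx rG w).
  by apply: rG_irr; rewrite ?cyclic_mx_module ?cyclic_mx_eq0.
have /cyclic_mxP[A /envelop_mxP[c ->] ->] : (v <= cyclic_mx rG w)%MS.
  exact: submx_full.
rewrite mulmx_sumr; apply: (big_ind W) => [|u1 u2 Wu1 Wu2|g _] //.
  by rewrite -[u1]scale1r; exact: Wlin.
rewrite -scalemxAr -[_ *: _]addr0; apply: Wlin => //.
by have := Wstab g^-1%g _ Ww; rewrite /= /row_action invgK.
Qed.

(** The matrix of [phi] is the intertwiner. This is what makes the representations of distinct socle
    components non-isomorphic. *)
Lemma mx_linrep_iso_rsim n1 n2 (rG1 : mx_representation F G n1)
    (rG2 : mx_representation F G n2) :
  rep_iso (mx_linrep rG1) (@rep_act _ _ (mx_linrep rG2)) setT ->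
  mx_rsim rG1 rG2.
Proof.
move=> [phi [phi_inj phi_surj phi_eq]].
pose B := lin1_mx phi.
have phiE v : phi v = v *m B by rewrite mul_rV_lin1.
have Bfree : row_free B.
  rewrite -kermx_eq0; apply/rowV0P => v /sub_kermxP vB.
  by apply: phi_inj; rewrite linear0 phiE.
have Bfull : row_full B.
  rewrite -sub1mx; apply/row_subP => i.
  have [v _ <-] : range phi (row i 1%:M) by rewrite phi_surj.
  by rewrite phiE submxMl.
exists B => //; first by rewrite -(eqP Bfree) (eqP Bfull).
move=> g _; apply/row_matrixP=> i; rewrite !rowE !mulmxA.
by have := phi_eq g^-1%g (delta_mx 0 i); rewrite /= /row_action invgK !phiE.
Qed.

End MatrixRepresentations.

(** * The span of a free family as a matrix representation *)

Section CoordinateRepresentation.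
Variables (F : fieldType) (gT : finGroupType) (V : lmodType F).
Local Notation G := [set: gT]%G.
Variables (a : gT -> V -> V) (N : nat) (D : 'I_N -> V).
Hypothesis D_free : lin_indep D.

(** The transpose reconciles the columns of [lincomb] with the row vectors on which matrix modules
    are built. *)
Definition of_row (v : 'rV[F]_N) : V := lincomb D v^T.

Lemma of_row_is_linear : linear of_row.
Proof.
move=> c u v; rewrite /of_row /lincomb scaler_sumr -big_split.
by apply: eq_bigr => i _; rewrite !mxE scalerDl scalerA.
Qed.

HB.instance Definition _ :=
  GRing.isLinear.Build F 'rV[F]_N V _ of_row of_row_is_linear.

Lemma of_row_inj : injective of_row.
Proof.
move=> u v Euv; apply/eqP; rewrite -subr_eq0; apply/eqP/trmx_inj.
by rewrite trmx0; apply: D_free; rewrite -/(of_row _) linearB /= Euv subrr.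
Qed.

Lemma range_of_row : range of_row = lin_span D.
Proof.
apply/seteqP; split=> _ [c _ <-]; first by exists c^T.
by exists c^T => //; rewrite /of_row trmxK.
Qed.

Definition row_span m (B : 'M[F]_(m, N)) : set V :=
  of_row @` [set v | (v <= B)%MS].

Lemma row_span1 : row_span 1%:M = lin_span D.
Proof.
rewrite -range_of_row; congr image; apply/seteqP; split=> v //= _.
exact: submx1.
Qed.

Lemma row_span_basis m m' (B : 'M[F]_(m, N)) (B' : 'M[F]_(m', N)) :
  row_free B -> (B :=: B')%MS ->
  is_basis (row_span B') (fun j => of_row (row j B)).
Proof.
move=> Bfree EB.
have combE c : lincomb (fun j => of_row (row j B)) c = of_row (c^T *m B).
  rewrite mulmx_sum_row linear_sum; apply: eq_bigr => j _.
  by rewrite linearZ /= mxE.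
split=> [c|].
  rewrite combE -(linear0 of_row) => /of_row_inj.
  rewrite -(mul0mx _ B) => /(row_free_inj Bfree) c0.
  by apply: trmx_inj; rewrite trmx0.
apply/seteqP; split=> [_ [c _ <-]|_ [v vB' <-]].
  by rewrite combE; exists (c^T *m B) => //=; rewrite -EB submxMl.
have /submxP[c ->] : (v <= B)%MS by rewrite EB.
by exists c^T => //; rewrite combE trmxK.
Qed.

(** A left action read on rows gives [P (g * h) = P h *m P g]; the inverse restores the order of the
    product. *)
Lemma mx_repr_of_action (P : gT -> 'M[F]_N) :
  is_left_action a -> (forall g v, a g (of_row v) = of_row (v *m P g)) ->
  mx_repr G (fun g => P g^-1%g).
Proof.
move=> [a1 aM] aP; split=> [|g h _ _]; apply/row_matrixP => i; rewrite !rowE.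
  by apply: of_row_inj; rewrite -aP invg1 a1 mulmx1.
by apply: of_row_inj; rewrite mulmxA -!aP invMg aM.
Qed.

Variable rG : mx_representation F G N.
Hypothesis rG_act : forall g v, a g (of_row v) = of_row (v *m rG g^-1%g).

Lemma row_span_subrep m (B : 'M[F]_(m, N)) :
  mxmodule rG B -> subrep a (lin_span D) (row_span B).
Proof.
move=> Bmod; split.
- split; first by exists 0; rewrite /= ?sub0mx ?linear0.
  move=> c _ _ [u uB <-] [v vB <-]; exists (c *: u + v); last by rewrite linearP.
  by rewrite /= addmx_sub ?scalemx_sub.
- by rewrite -range_of_row => _ [v _ <-]; exists v.
- move=> g _ [v vB <-]; exists (v *m rG g^-1%g); rewrite ?rG_act //=.
  by apply: mxmodule_trans vB; rewrite ?inE.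
Qed.

(** * Isotypic components as socle components *)

Section SimpleModule.
Variables (U : 'M[F]_N) (simU : mxsimple rG U).
Let modU := mxsimple_module simU.
Let S := mx_linrep (submod_repr modU).

(** The isomorphism is the inclusion of [U], followed by the module isomorphism [f], followed by
    [of_row]. *)
Lemma rep_iso_row_span W : mx_iso rG U W -> rep_iso S a (row_span W).
Proof.
move=> [f f_unit homf UfW].
pose phi (s : S) := of_row (val_submod s *m f).
have phi_lin : linear phi.
  by move=> c s t; rewrite /phi linearP mulmxDl -scalemxAl linearP.
pose L : {linear S -> V} :=
  HB.pack phi (GRing.isLinear.Build _ _ _ _ _ phi_lin).
exists L; split.
- by move=> s t /of_row_inj/(can_inj (mulmxK f_unit))/val_submod_inj.
- apply/seteqP; split=> [_ [s _ <-]|_ [v vW <-]].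
    exists (val_submod s *m f) => //=.
    by rewrite -UfW submxMr // val_submodP.
  have /submxP[c cE] : (v <= U *m f)%MS by rewrite UfW.
  exists (in_submod U (c *m U)) => //=.
  by rewrite /phi in_submodK ?submxMl // -mulmxA -cE.
- move=> g s; rewrite /= /phi rG_act /= /row_action val_submodJ ?inE //.
  by rewrite (hom_mxP (submx_trans (val_submodP _) homf)) ?inE.
Qed.

(** In coordinates [phi] becomes a module homomorphism out of the simple [U]; its image is zero or
    isomorphic to [U], hence inside the component. *)
Lemma rep_iso_sub_component W :
  W `<=` lin_span D -> rep_iso S a W -> W `<=` row_span (component_mx rG U).
Proof.
move=> WD [phi [phi_inj phiW phi_eq]].
have /choice[A0 A0E] : forall j, exists v, of_row v = phi (delta_mx 0 j).
  move=> j; have : lin_span D (phi (delta_mx 0 j)).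
    by apply: WD; rewrite -phiW; exists (delta_mx 0 j).
  by rewrite -range_of_row => -[v _ <-]; exists v.
pose A := \matrix_j A0 j.
have phiE s : phi s = of_row (s *m A).
  rewrite {1}(row_sum_delta s) linear_sum mulmx_sum_row linear_sum.
  by apply: eq_bigr => j _; rewrite !linearZ /= rowK A0E.
have Aeq (s : 'rV_(\rank U)) g : s *m submod_repr modU g *m A = s *m A *m rG g.
  apply: of_row_inj; have := phi_eq g^-1%g s.
  by rewrite /= /row_action invgK !phiE rG_act invgK.
(* [dom_hom_mx] expects a square matrix, so [A] is extended from [U] to all rows through
   [in_submod]. *)
pose f := in_submod U 1%:M *m A.
have fE m (B : 'M_(m, N)) : B *m f = in_submod U B *m A.
  by rewrite mulmxA -in_submodE.
have homf : (U <= dom_hom_mx rG f)%MS.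
  apply/hom_mxP=> g _; rewrite !fE in_submodJ //.
  by apply/row_matrixP=> i; rewrite !row_mul Aeq.
have fcomp : (U *m f <= component_mx rG U)%MS.
  have [->|Uf_neq0] := eqVneq (U *m f) 0; first exact: sub0mx.
  by apply: mx_iso_component => //; exact: mx_Schur_inj_iso.
rewrite -phiW => _ [s _ <-]; rewrite phiE; exists (s *m A) => //=.
apply: submx_trans fcomp; rewrite -(val_submodK (U := U) s) -fE.
by rewrite submxMr // val_submodP.
Qed.

(** One inclusion is [rep_iso_sub_component]; for the other, [component_mx] is a sum of modules
    isomorphic to [U]. *)
Lemma isotypic_component :
  isotypic S a (lin_span D) = row_span (component_mx rG U).
Proof.
have [[comp0 comp_lin] _ _] :
    subrep a (lin_span D) (row_span (component_mx rG U)).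
  exact/row_span_subrep/component_mx_module.
apply/seteqP; split=> [_ [k [w [wP ->]]]|].
  apply: (big_ind (row_span (component_mx rG U))) => // [u v uC vC|i _].
    by rewrite -[u]scale1r; exact: comp_lin.
  have [W [[_ WU _] isoW Ww]] := wP i.
  exact: (rep_iso_sub_component WU isoW).
move=> _ [v vC <-]; move: vC => /=.
have [I [W isoW ->]] := component_mx_def simU.
move=> /sub_sumsmxP[c ->].
exists #|I|, (fun i => of_row (c (enum_val i) *m W (enum_val i))); split.
  move=> i; exists (row_span (W (enum_val i))); split.
  - exact/row_span_subrep/(mx_iso_module (isoW _)).
  - exact: rep_iso_row_span.
  - by exists (c (enum_val i) *m W (enum_val i)) => //=; exact: submxMl.
by rewrite linear_sum (big_enum_val (A := I)).
Qed.

End SimpleModule.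

(** By Maschke the socle is everything, so stacking row bases of its components gives a basis of the
    row space. *)
Lemma isotypic_basis_exists : ([pchar F]^'.-group G)%g ->
  exists k (S : 'I_k -> linrep F gT) (d : 'I_k -> nat)
         (b : 'I_(\sum_i d i) -> V),
    isotypic_basis a (lin_span D) S b.
Proof.
move=> charG.
(* [socle_exists] serves only boolean goals, hence the proof by contradiction. *)
have [sG _] : exists sG : socleType rG, True.
  apply: contrapT => no_sG; suff: false by [].
  by apply: (socle_exists rG) => sG; case: no_sG; exists sG.
have socle1 := reducible_Socle1 sG (mx_Maschke_pchar rG charG).
pose C (i : 'I_#|sG|) : 'M[F]_N := socle_val (enum_val i).
pose B := \mxcol_i row_base (C i).
have sumC : (\sum_i <<row_base (C i)>> = 1%:M :> 'M[F]_N)%MS.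
  rewrite -socle1 /Socle [RHS](big_enum_val (A := sG)) /=.
  by apply: eq_bigr => i _; rewrite (eq_genmx (eq_row_base _)) genmx_component.
(* Directness of the socle makes the number of rows of [B] equal to [N], so spanning gives
   freeness. *)
have rankC : (\sum_i \rank (C i))%N = N.
  have : \rank (Socle sG) = (\sum_(W : sG) \rank W)%N.
    exact: mxdirectP (Socle_direct sG).
  by rewrite socle1 mxrank1 (big_enum_val (A := sG)).
have BE : (B :=: 1%:M)%MS by rewrite -sumC; exact: eqmx_col.
have Bfree : row_free B by rewrite /row_free BE mxrank1 rankC.
exists #|sG|, (fun i => mx_linrep (socle_repr (enum_val i))),
  (fun i => \rank (C i)), (fun s => of_row (row s B)); split.
- by move=> i; apply: mx_linrep_irreducible; exact: socle_irr.
- by move=> i j /mx_linrep_iso_rsim/socle_rsimP/eqP/enum_val_inj.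
- move=> i; rewrite isotypic_component.
  have -> : (fun j => of_row (row (tagnat.Rank i j) B)) =
      (fun j => of_row (row j (row_base (C i)))).
    apply/funext => j; congr of_row.
    rewrite -[row_base (C i)](mxcolK (fun i => row_base (C i))).
    by apply/rowP=> l; rewrite !mxE.
  exact: row_span_basis (row_base_free _) (eq_row_base _).
- by rewrite -row_span1; exact: row_span_basis.
Qed.

End CoordinateRepresentation.

(** * Block diagonal matrices from invariant blocks *)

Section BlockDiagonal.
Variables (F : fieldType) (V : lmodType F) (k : nat) (d : 'I_k -> nat).
Variables (b : 'I_(\sum_i d i) -> V) (T : V -> V).

(** Coordinates of the image of a vector of block [i] can be chosen within that block, with zeros
    elsewhere. *)
Lemma is_matrix_of_mxdiag :
  (forall i j,
     lin_span (fun j => b (tagnat.Rank i j)) (T (b (tagnat.Rank i j)))) ->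
  exists B : forall i, 'M[F]_(d i), is_matrix_of T b (\mxdiag_i B i).
Proof.
move=> Tb.
have c i j : {c | lincomb (fun j => b (tagnat.Rank i j)) c
                  = T (b (tagnat.Rank i j))}.
  by apply: cid; have [c _ <-] := Tb i j; exists c.
pose B i : 'M[F]_(d i) := \matrix_(r, j) sval (c i j) r 0.
exists B => s; rewrite -(tagnat.sig2K s).
move: (tagnat.sig1 s) (tagnat.sig2 s) => i j.
rewrite -(svalP (c i j)) /lincomb (reindex _ tagnat.rank_bij_on) /=.
(* [conform_mx] comes from [\mxdiag]: the diagonal block must have type ['M_(d i', d i)], which
   matches that of [B i'] only when [i' = i]. *)
have BE i' j' : (\mxdiag_i B i) (tagnat.Rank i' j') (tagnat.Rank i j)
    = (if i' == i then conform_mx 0 (B i') else 0) j' j.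
  pose E i j : 'M[F]_(d i, d j) := if i == j then conform_mx 0 (B i) else 0.
  by have /matrixP/(_ j' j) := mxblockK E i' i; rewrite mxE.
transitivity (\sum_i' \sum_(j' < d i')
    (\mxdiag_i B i) (tagnat.Rank i' j') (tagnat.Rank i j)
      *: b (tagnat.Rank i' j')); last first.
  rewrite sig_big_dep /=; apply: eq_bigr => -[i' j'] _.
  by rewrite [col _ _ _ _]mxE.
rewrite (bigD1 i) //= [X in _ + X]big1 => [|i' /negPf i'i]; last first.
  by rewrite big1 // => j' _; rewrite BE i'i mxE scale0r.
rewrite addr0; apply: eq_bigr => j' _.
by rewrite BE eqxx conform_mx_id mxE.
Qed.

End BlockDiagonal.

Unset Implicit Arguments.
Set Strict Implicit.
Local Close Scope sesquilinear_scope.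
Local Close Scope classical_set_scope.

(** The existence clause keeps the last clause, which ranges over all adapted bases, from being
    vacuous. *)
Theorem mainTheorem3 (R : realType) (gT : finGroupType) (n : nat)
  (rho : gT -> 'rV[R]_n -> 'rV[R]_n)
  (rho_action : is_left_action rho)
  (rho_faithful : injective rho)
  (M : nat) (x y : 'I_M -> 'rV[R]_n)
  (data_symmetric : forall g : gT,
     perm_eq [seq (rho g (x m), rho g (y m)) | m : 'I_M]
             [seq (x m, y m) | m : 'I_M])
  (e : 'I_#|gT| -> gT) (e_bij : bijective e)
  (p : nat) (psi : 'I_p -> observable R n)
  (dict_free : lin_indep (dict rho e psi)) :
  let D := dict rho e psi in
  let G := edmd_G rho e psi x in
  let A := edmd_A rho e psi x y in
  let K := edmd_K rho e psi x y in
  let P := bigperm_G R e p in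
  let act := obs_act rho in
  let T := lin_op D K in
  (forall g : gT, [/\ P g *m G = G *m P g, P g *m A = A *m P g
                    & P g *m K = K *m P g])
  /\ (forall S : linrep R[i] gT, irreducible_rep S ->
        forall f, isotypic S act (lin_span D) f ->
                  isotypic S act (lin_span D) (T f))
  /\ (exists (k : nat) (S : 'I_k -> linrep R[i] gT) (d : 'I_k -> nat)
             (b : 'I_(\sum_i d i) -> observable R n),
        isotypic_basis act (lin_span D) S b)
  /\ (forall (k : nat) (S : 'I_k -> linrep R[i] gT) (d : 'I_k -> nat)
             (b : 'I_(\sum_i d i) -> observable R n),
        isotypic_basis act (lin_span D) S b ->
        exists B : forall i, 'M[R[i]]_(d i),
          is_matrix_of T b (\mxdiag_i B i)).
Proof.
move=> D G A K P act T.
have cP g : [/\ P g *m G = G *m P g, P g *m A = A *m P g & P g *m K = K *m P g].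
  (* The inverse appears because observables are translated through [rho g^-1]. *)
  have sym := data_symmetric g^-1%g.
  by split; [exact: edmd_G_comm sym|exact: edmd_A_comm|exact: edmd_K_comm].
have actP g v : act g (of_row D v) = of_row D (v *m P g).
  apply/funext => z; rewrite /act /obs_act /of_row !lincomb_dictE.
  by rewrite (Psi_act rho_action psi e_bij) trmx_mul mulmxA.
pose rG := MxRepresentation
  (mx_repr_of_action dict_free (obs_act_left rho_action) actP).
have rG_act g v : act g (of_row D v) = of_row D (v *m rG g^-1%g).
  by rewrite actP /= invgK.
have TE v : T (of_row D v) = of_row D (v *m K^T).
  by rewrite /T lin_opE // /of_row trmx_mul trmxK.
have [D_sub _ D_stab] : subrep act (lin_span D) (lin_span D).
  by have := row_span_subrep rG_act (mxmodule1 rG); rewrite row_span1.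
have T_isotypic S : irreducible_rep S -> forall f,
    isotypic S act (lin_span D) f -> isotypic S act (lin_span D) (T f).
  move=> S_irr; apply: isotypic_equivariant_stable => //.
  - rewrite -range_of_row => c _ _ [u _ <-] [v _ <-].
    by rewrite -linearP !TE -linearP /= mulmxDl scalemxAl.
  - by rewrite -range_of_row => _ [u _ <-]; rewrite TE; exists (u *m K^T).
  - rewrite -range_of_row => g _ [u _ <-]; rewrite actP !TE actP -!mulmxA.
    congr (of_row D (_ *m _)).
    have PPT : P g *m (P g)^T = 1%:M.
      by rewrite -bigperm_G_real bigperm_G_unitary.
    have [_ _ cK] := cP g.
    (* On rows [T] is multiplication by [K^T], so equivariance needs [K] to commute with [(P g)^T],
       the inverse of [P g]. *)
    have cKT : (P g)^T *m K = K *m (P g)^T.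
      rewrite -[LHS]mulmx1 -PPT mulmxA -(mulmxA _ K) -cK mulmxA.
      by rewrite (mulmx1C PPT) mul1mx.
    by apply: trmx_inj; rewrite (trmx_mul (P g)) (trmx_mul K^T) trmxK cKT.
do 3?split=> //.
  apply: (isotypic_basis_exists dict_free rG_act).
  (* The group order is a nonzero complex number, as Maschke's theorem requires. *)
  by rewrite /pgroup pcharf'_nat pnatr_eq0 -lt0n cardG_gt0.
move=> k S d b [S_irr _ b_iso _].
apply: is_matrix_of_mxdiag => i j.
have [_ ->] := b_iso i; apply: T_isotypic => //.
have [_ <-] := b_iso i; exists (delta_mx j 0) => //.
rewrite /lincomb (bigD1 j) //= mxE !eqxx scale1r big1 ?addr0 // => l /negPf lj.
by rewrite mxE lj scale0r.
Qed.
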